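(* Let $\phi$ be a $C^2$ strictly convex function on $\mathbb{R}$ such that $\lim_{|x|\to\infty}\phi(x)/|x|=\infty$ and $\int e^{-\phi(x)}dx=1$, and let $\mu_\phi(dx)=e^{-\phi(x)}dx$. Assume that for any $R>0$, $$\int \big(|z|+|y_0|+R\big)^2\Big(|\phi'(z)|+\sup_{y:\ |y-z+y_0|\le R}|\phi''(y)|\Big)\,d\mu_\phi(z)<+\infty ,$$ where $y_0$ satisfies $|\phi'(y_0)|\le|\phi'(z)|+R$. Assume that $\phi$ is even, $\phi(0)=0$, $\phi''$ is decreasing on $]-\infty,0]$ and increasing on $[0,+\infty[$, and that $$\forall x\in\mathbb{R},\quad \phi''(x)\ge\phi''(0)=\lambda>0\quad\text{and}\quad \lim_{|x|\to\infty}\phi''(x)=\infty .$$ Assume also that there exists $A>1$ such that, for $|x|\ge C$ for some $C>0$, $$A\phi(x)\le x\phi'(x).$$ Then there exists $C>0$ such that for all smooth enough functions $g$, $$\mathrm{Ent}_{\mu_\phi}(e^g)\le\int H_\phi(g')\,e^g\,d\mu_\phi,$$ where $$H_\phi(x)=\begin{cases}\dfrac{2A}{A-1}\,\phi^*\!\left(\dfrac{x}{2}\right)&\text{if }|x|>C,\\[2mm] \dfrac{1}{2\lambda}x^2&\text{if }|x|\le C.\end{cases}$$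
   Context: $dx$ is Lebesgue measure on $\mathbb{R}$. The Fenchel-Legendre transform of $\phi$ is $\phi^*(x)=\sup_{z\in\mathbb{R}}\{xz-\phi(z)\}$. The entropy is $\mathrm{Ent}_{\mu_\phi}(e^g)=\int e^g\log\frac{e^g}{\int e^g\,d\mu_\phi}\,d\mu_\phi$. *)

(* Defs.v *)
From HB Require Import structures.
From mathcomp Require Import all_boot all_order all_algebra.
From mathcomp Require Import all_classical all_reals all_analysis.

Set Implicit Arguments.
Unset Strict Implicit.
Unset Printing Implicit Defensive.

Import Order.TTheory GRing.Theory Num.Theory.
Import numFieldNormedType.Exports.

Local Open Scope classical_set_scope.
Local Open Scope ring_scope.

Definition C1_fun (R : realType) (f : R -> R) : Prop :=
  (forall x, derivable f x 1) /\ continuous (derive1 f).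

Definition C2_fun (R : realType) (f : R -> R) : Prop :=
  (forall x, derivable f x 1) /\ C1_fun (derive1 f).

Definition strictly_convex (R : realType) (f : R -> R) : Prop :=
  forall x y t : R, x != y -> 0 < t < 1 ->
    f (t * x + (1 - t) * y) < t * f x + (1 - t) * f y.

(* The integral of F with respect to mu_phi(dx) = e^{-phi(x)} dx. *)
Definition muint (R : realType) (phi : R -> R) (F : R -> \bar R) : \bar R :=
  (\int[lebesgue_measure]_(x in setT) (F x * (expR (- phi x))%:E))%E.

Definition fenchel (R : realType) (phi : R -> R) (x : R) : \bar R :=
  ereal_sup [set (x * z - phi z)%:E | z in [set: R]].

(* Meaningful when e^g is mu_phi-integrable.  The negative part of the
   integrand is then integrable, because t ln t is bounded below, so the value
   is a well-defined element of ]-oo, +oo]. *)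
Definition Ent (R : realType) (phi : R -> R) (g : R -> R) : \bar R :=
  let m := fine (muint phi (fun x => (expR (g x))%:E)) in
  muint phi (fun x => (expR (g x) * ln (expR (g x) / m))%:E).

Definition H_fun (R : realType) (phi : R -> R) (A lambda C : R) (x : R)
    : \bar R :=
  if C < `|x| then ((2 * A / (A - 1))%:E * fenchel phi (x / 2))%E
  else ((2 * lambda)^-1 * x ^+ 2)%:E.

(* The point y_0 of the integrability condition depends on z, being constrained
   only by |phi'(y_0)| <= |phi'(z)| + r; finiteness is required for every
   measurable choice z |-> y_0 z of such points. *)
Definition integrability_condition (R : realType) (phi : R -> R) : Prop :=
  forall r : R, 0 < r ->
  forall y0 : R -> R, measurable_fun setT y0 ->
    (forall z, `|derive1 phi (y0 z)| <= `|derive1 phi z| + r) ->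
    (muint phi (fun z =>
       ((`|z| + `|y0 z| + r) ^+ 2)%:E *
       ((`|derive1 phi z|)%:E +
        ereal_sup [set (`|derive1 (derive1 phi) y|)%:E |
                     y in [set y : R | (`|y - z + y0 z| <= r)%R]]))
     < +oo)%E.

(* Main.v *)
Require Import Defs.
From HB Require Import structures.
From mathcomp Require Import all_boot all_order all_algebra.
From mathcomp Require Import all_classical all_reals all_analysis.
From mathcomp Require Import measurable_realfun.
From mathcomp Require Import ring lra.

(* Let T be the increasing map transporting e^g mu_phi / m onto mu_phi, where
   m is the integral of e^g.  Writing the entropy as the integral of
   phi(x) - phi(T x) + ln T'(x), using ln T' <= T' - 1 and integrating by parts
   leaves the integral of phi(x) - phi(T x) + (T x - x)(phi'(x) - g'(x)), which
   one would like to bound pointwise by H_phi(g').  This is possible when x and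
   T x have the same sign, and always with g'^2 / (2 lambda), but it can fail
   when |g'| is large and x and T x lie on opposite sides of 0 (already for phi
   close to |x|^3).  So the displacement is measured by s(T x) - x instead, with
   ln (s' T') <= s' T' - 1, where s is the identity except on a half-line on
   which it is clamped: for x >= X, s(t) = t on t >= 1 and s > 0 elsewhere; for
   0 <= x <= X, s(t) = t on t >= - M and s > - M - 1 elsewhere; symmetrically for
   x <= 0.  The cost - ln s' of the clamping is absorbed by - phi(T x) and, for
   x >= X, by x phi'(x) - 2 phi(x), which exceeds phi'(x) by any given constant
   because phi'' -> oo.  Switching between the clamps
   at 0 and at +-X only produces boundary terms of the right sign. *)

Set Implicit Arguments.
Unset Strict Implicit.
Unset Printing Implicit Defensive.

Import Order.TTheory GRing.Theory Num.Theory.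
Import numFieldNormedType.Exports.

Local Open Scope classical_set_scope.
Local Open Scope ring_scope.

Local Notation mu := lebesgue_measure.

(** * Continuity and monotonicity from derivatives *)

Lemma is_derive_continuous (R : realType) (f f' : R -> R) :
  (forall x, is_derive x (1 : R) f (f' x)) -> continuous f.
Proof.
move=> df x; apply/differentiable_continuous/derivable1_diffP.
exact: ex_derive.
Qed.

Lemma is_derive_le (R : realType) (f f' : R -> R) (a b : R) : a <= b ->
  (forall x, is_derive x (1 : R) f (f' x)) ->
  (forall x, a <= x <= b -> 0 <= f' x) -> f a <= f b.
Proof.
move=> ab df f'0; rewrite -subr_ge0.
have cf : {within `[a, b], continuous f}.
  exact/continuous_subspaceT/is_derive_continuous.
have [c cab ->] := MVT_segment ab (fun x _ => df x) cf.
by rewrite mulr_ge0 ?subr_ge0// f'0//; move: cab; rewrite in_itv.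
Qed.

(** * One-sided C^1 clamps of the identity *)

Section soft_clamp.
Context (R : realType).
Implicit Types c t v : R.

(** Equal to 1 for [v >= 0] and to [1 / (1 - v)] for [v <= 0]. With this choice [v * soft_scale v]
    has derivative [soft_scale v ^+ 2], which is positive and continuous. *)
Definition soft_scale v : R := (1 + Num.max (- v) 0)^-1.

(* The identity on [c, +oo[, continued to the left as a C^1 increasing function
   bounded below by c - 1. *)
Definition soft_clamp c t : R := c + (t - c) * soft_scale (t - c).

Lemma soft_scale_den_gt0 v : 0 < 1 + Num.max (- v) 0.
Proof. by rewrite ltr_pwDl// le_max lexx orbT. Qed.

Lemma soft_scale_gt0 v : 0 < soft_scale v.
Proof. by rewrite invr_gt0 soft_scale_den_gt0. Qed.

Lemma continuous_soft_scale : continuous soft_scale.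
Proof.
move=> v; apply: cvgV; first by rewrite gt_eqF// soft_scale_den_gt0.
apply: cvgD; first exact: cvg_cst.
apply: continuous_max; [exact: cvgN|exact: cvg_cst].
Qed.

Lemma soft_scale_nonneg v : 0 <= v -> soft_scale v = 1.
Proof. by move=> v0; rewrite /soft_scale max_r ?oppr_le0// addr0 invr1. Qed.

Lemma soft_scale_nonpos v : v <= 0 -> soft_scale v = (1 - v)^-1.
Proof. by move=> v0; rewrite /soft_scale max_l ?oppr_ge0. Qed.

Lemma is_derive_soft_scale v :
  is_derive v (1 : R) (fun v => v * soft_scale v) (soft_scale v ^+ 2).
Proof.
have [v0|v0|->] := ltgtP v 0.
- have v1 : 1 - v != 0 by rewrite gt_eqF// subr_gt0 (lt_trans v0).
  apply: (@near_eq_is_derive _ _ _ (fun v => v * (1 - v)^-1)).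
    near=> z; rewrite soft_scale_nonpos// ltW//.
    by near: z; exact: lt_nbhsl.
  have d1 : is_derive v (1 : R) (fun v => 1 - v) (- 1).
    by apply: is_derive_eq; rewrite /GRing.scale /=; ring.
  have dV := @is_deriveV _ (fun v => 1 - v) _ _ _ v1 d1.
  apply: is_derive_eq.
  by rewrite soft_scale_nonpos ?ltW// /GRing.scale /=; field.
- apply: (@near_eq_is_derive _ _ _ id).
    near=> z; rewrite soft_scale_nonneg ?mulr1// ltW//.
    by near: z; exact: lt_nbhsr.
  by apply: is_derive_eq; rewrite soft_scale_nonneg ?ltW// expr1n.
(* At the junction 0 the difference quotient is [soft_scale] itself, so its continuity yields the
   derivative. *)
- apply/is_derive1_caratheodory; exists soft_scale; split.
  + by move=> z; rewrite mul0r !subr0 mulrC.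
  + exact: continuous_soft_scale.
  + by rewrite soft_scale_nonneg// expr1n.
Unshelve. all: by end_near. Qed.

Lemma is_derive_soft_clamp c t :
  is_derive t (1 : R) (soft_clamp c) (soft_scale (t - c) ^+ 2).
Proof.
have d1 : is_derive t (1 : R) (fun t => t - c) 1.
  by apply: is_derive_eq; ring.
have d2 := is_derive_soft_scale (t - c).
have d := @is_derive1_comp _ (fun v => v * soft_scale v) (fun t => t - c) _ _ _
  d2 d1.
apply: (@near_eq_is_derive _ _ _
  (fun t => c + ((fun v => v * soft_scale v) \o (fun t => t - c)) t)) => //.
  by near=> z; rewrite /soft_clamp.
rewrite -[X in is_derive _ _ _ X]add0r -[X in 0 + X]mulr1.
exact: (is_deriveD (is_derive_cst c t 1) d).
Unshelve. all: by end_near.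
Qed.

Lemma soft_clamp_id c t : c <= t -> soft_clamp c t = t.
Proof.
by move=> ct; rewrite /soft_clamp soft_scale_nonneg ?subr_ge0// mulr1 subrKC.
Qed.

Lemma soft_clamp_gt c t : c - 1 < soft_clamp c t.
Proof.
rewrite ltrD2l; set v := t - c.
have [v0|v0] := leP 0 v; first by rewrite soft_scale_nonneg// mulr1; lra.
rewrite soft_scale_nonpos ?ltW// ltr_pdivlMr; lra.
Qed.

Lemma soft_clamp_le c t : t <= c -> soft_clamp c t <= c.
Proof.
by move=> tc; rewrite gerDl mulr_le0_ge0 ?subr_le0// ltW// soft_scale_gt0.
Qed.

(** The left-hand side is [2 * ln (1 + (c - t))]. The price of clamping is thus at most linear in
    [t], so that a quadratic lower bound on [phi t] can absorb it. *)
Lemma ln_soft_scale_ge c t : t <= c ->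
  - ln (soft_scale (t - c) ^+ 2) <= 2 * (c - t).
Proof.
move=> tc; rewrite lnXn ?soft_scale_gt0// soft_scale_nonpos ?subr_le0//.
rewrite lnV ?posrE; last by lra.
have := @le_ln1Dx R (c - t) ltac:(lra).
have -> : 1 - (t - c) = 1 + (c - t) by ring.
by rewrite mulr2n; lra.
Qed.

Lemma soft_clamp_ge c t : t <= soft_clamp c t.
Proof.
have [ct|/ltW tc] := leP c t; first by rewrite soft_clamp_id.
have s1 : soft_scale (t - c) <= 1.
  by rewrite soft_scale_nonpos ?subr_le0// invf_le1; lra.
have : 0 <= (c - t) * (1 - soft_scale (t - c)) by rewrite mulr_ge0 ?subr_ge0.
by rewrite /soft_clamp; lra.
Qed.

(** This fixes the sign of the boundary terms at the points where the clamp level changes. *)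
Lemma soft_clamp_le_level a b t : a <= b -> soft_clamp a t <= soft_clamp b t.
Proof.
move=> ab; have [at'|/ltW ta] := leP a t.
  by rewrite soft_clamp_id// soft_clamp_ge.
have tb := le_trans ta ab.
rewrite -subr_ge0 /soft_clamp !soft_scale_nonpos ?subr_le0//.
have a1 : 1 <= 1 - (t - a) by lra.
have b1 : 1 <= 1 - (t - b) by lra.
(* For [t <= c] the clamp is [c - 1 + (1 - (t - c))^-1], hence the factorization; both inverses are
   at most 1. *)
rewrite [leRHS](_ : _ = (b - a) *
  (1 - (1 - (t - a))^-1 * (1 - (t - b))^-1)); last by field; lra.
rewrite mulr_ge0 ?subr_ge0// mulr_ile1 ?invr_ge0 ?invf_le1//; lra.
Qed.

End soft_clamp.

(** * Convexity estimates for the potential *)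

Section potential.
Context (R : realType) (phi p m : R -> R) (l : R).
Hypothesis dphi : forall x, is_derive x (1 : R) phi (p x).
Hypothesis dp : forall x, is_derive x (1 : R) p (m x).
Hypothesis phi0 : phi 0 = 0.
Hypothesis p0 : p 0 = 0.
Hypothesis phi_even : forall x, phi (- x) = phi x.
Hypothesis l_gt0 : 0 < l.
Hypothesis m_ge : forall x, l <= m x.
Hypothesis m_incr : forall x y, 0 <= x -> x <= y -> m x <= m y.
Hypothesis m_pinfty : forall K, exists2 N, 0 < N & forall x, N <= x -> K <= m x.

Lemma grad_mono (x y : R) : x <= y -> l * (y - x) <= p y - p x.
Proof.
move=> xy; rewrite -subr_ge0.
have := @is_derive_le R (fun t => p t - l * t) (fun t => m t - l) _ _ xy.
have dh (t : R) : is_derive t (1 : R) (fun t => p t - l * t) (m t - l).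
  by apply: is_derive_eq; rewrite /GRing.scale /=; ring.
by move=> /(_ dh) H; have := H (fun t _ => ltac:(by rewrite subr_ge0 m_ge));
  lra.
Qed.

(** Strong convexity: the remainder [f] vanishes at [x], and by [grad_mono] its derivative has the
    sign of [s - x]. *)
Lemma potential_ge_quadratic (x t : R) :
  phi x + p x * (t - x) + l / 2 * (t - x) ^+ 2 <= phi t.
Proof.
pose f s := phi s - phi x - p x * (s - x) - l / 2 * (s - x) ^+ 2.
pose f' s := p s - p x - l * (s - x).
have df (s : R) : is_derive s (1 : R) f (f' s).
  by apply: is_derive_eq; rewrite /f' /GRing.scale /=; field.
have dNf (s : R) : is_derive s (1 : R) (fun s => - f s) (- f' s).
  by apply: is_derive_eq.
have fx : f x = 0 by rewrite /f; ring.
suff : 0 <= f t by rewrite /f; lra.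
have [xt|/ltW tx] := leP x t.
  rewrite -fx; apply: (is_derive_le xt df) => s /andP[xs _].
  by rewrite /f' subr_ge0 grad_mono.
rewrite -lerN2 oppr0 -oppr0 -fx; apply: (is_derive_le tx dNf) => s /andP[_ sx].
by rewrite /f' ; have := grad_mono sx; lra.
Qed.

Lemma potential_ge (t : R) : l / 2 * t ^+ 2 <= phi t.
Proof. by have := potential_ge_quadratic 0 t; rewrite phi0 p0 !subr0; lra. Qed.

Lemma potential_ge0 (t : R) : 0 <= phi t.
Proof.
by apply: le_trans (potential_ge t); rewrite mulr_ge0 ?sqr_ge0// divr_ge0// ltW.
Qed.

Lemma grad_ge (x : R) : 0 <= x -> l * x <= p x.
Proof. by move=> x0; have := grad_mono x0; rewrite p0 !subr0. Qed.

Lemma grad_ge0 (x : R) : 0 <= x -> 0 <= p x.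
Proof. by move=> x0; apply: le_trans (grad_ge x0); rewrite mulr_ge0// ltW. Qed.

Lemma grad_increment_le (x y : R) : 0 <= x -> x <= y ->
  p y - p x <= m y * (y - x).
Proof.
move=> x0 xy; have cp : {within `[x, y], continuous p}.
  exact/continuous_subspaceT/is_derive_continuous.
have [c] := MVT_segment xy (fun x _ => dp x) cp.
rewrite in_itv /= => /andP[xc cy ->].
by rewrite ler_wpM2r ?subr_ge0// m_incr// (le_trans x0).
Qed.

Lemma grad_increment_ge (x y : R) : 0 <= x -> x <= y ->
  m x * (y - x) <= p y - p x.
Proof.
move=> x0 xy; have cp : {within `[x, y], continuous p}.
  exact/continuous_subspaceT/is_derive_continuous.
have [c] := MVT_segment xy (fun x _ => dp x) cp.
rewrite in_itv /= => /andP[xc cy ->].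
by rewrite ler_wpM2r ?subr_ge0// m_incr// (le_trans x0).
Qed.

(** Convexity of [p] on the half-line, where its derivative [m] increases. *)
Lemma grad_tangent (z s : R) : 0 <= z -> 0 <= s -> p z + m z * (s - z) <= p s.
Proof.
move=> z0 s0; have [zs|/ltW sz] := leP z s.
  by have := grad_increment_ge z0 zs; lra.
by have := grad_increment_le s0 sz; lra.
Qed.

(* On [0, +oo[ the potential dominates the primitive of the positive part of
   the tangent line to its derivative at z; conclude by AM-GM. *)
Lemma potential_ge_chord (x z : R) : 0 <= x -> 0 <= z ->
  2 * (x - z) * p z <= phi x.
Proof.
move=> x0 z0; have [xz|/ltW zx] := leP x z.
  apply: le_trans (potential_ge0 x).
  by rewrite mulr_le0_ge0 ?grad_ge0//; lra.
have mz0 : 0 < m z by rewrite (lt_le_trans l_gt0).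
(* The zero of the tangent line to [p] at [z]; it is nonnegative because [p z <= m z * z]. *)
set a := z - p z / m z.
have pzE : p z = m z * (z - a) by rewrite /a; field; rewrite gt_eqF.
have za : a <= z by rewrite /a gerBl divr_ge0 ?grad_ge0// ltW.
have a0 : 0 <= a.
  rewrite /a subr_ge0 ler_pdivrMr//.
  by have := grad_increment_le (lexx 0) z0; rewrite p0; lra.
pose f s := phi s - m z / 2 * (s - a) ^+ 2.
have df (s : R) : is_derive s (1 : R) f (p s - m z * (s - a)).
  by apply: is_derive_eq; rewrite /GRing.scale /=; field.
have fa : 0 <= f a by rewrite /f subrr expr0n mulr0 subr0 potential_ge0.
have : f a <= f x.
  apply: (is_derive_le (le_trans za zx) df) => s /andP[as' _].
  by have := grad_tangent z0 (le_trans a0 as'); rewrite pzE; lra.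
move=> /(le_trans fa); rewrite /f subr_ge0; apply: le_trans.
rewrite pzE -subr_ge0.
have -> : m z / 2 * (x - a) ^+ 2 - 2 * (x - z) * (m z * (z - a)) =
  m z / 2 * (x + a - 2 * z) ^+ 2 by field.
by rewrite mulr_ge0 ?sqr_ge0// divr_ge0// ltW.
Qed.

Lemma potential_gap_ge0 (x : R) : 0 <= x -> 2 * phi x <= x * p x.
Proof.
move=> x0; rewrite -subr_ge0.
pose f s := s * p s - 2 * phi s.
have df (s : R) : is_derive s (1 : R) f (s * m s - p s).
  by apply: is_derive_eq; rewrite /GRing.scale /=; ring.
have f0 : f 0 = 0 by rewrite /f phi0; ring.
rewrite -[leLHS]f0; apply: (is_derive_le x0 df) => s /andP[s0 _].
by have := grad_increment_le (lexx 0) s0; rewrite p0; lra.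
Qed.

Lemma potential_gap_infty (c : R) : exists2 X, 1 <= X &
  forall x, X <= x -> 2 * phi x + p x + c <= x * p x.
Proof.
(* For [s >= 2], [p s <= (s - 2) * m s + 2 * m 2], hence [f' s >= m s - 2 * m 2 - 1], which this
   threshold makes nonnegative. *)
have [N N0 HN] := m_pinfty (2 * m 2 + 1).
pose f s := s * p s - 2 * phi s - p s - s.
pose f' s := s * m s - p s - m s - 1.
have df (s : R) : is_derive s (1 : R) f (f' s).
  by apply: is_derive_eq; rewrite /f' /GRing.scale /=; ring.
pose N2 := Num.max N 2.
have N22 : 2 <= N2 by rewrite le_max lexx orbT.
(* Because of the summand [- s] in [f], monotonicity leaves a surplus of [x + f N2], which covers
   [c] for [x] this large. *)
exists (Num.max N2 (N2 + c - f N2)) => [|x].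
  by rewrite le_max; apply/orP; left; lra.
rewrite ge_max => /andP[Nx xN].
have : f N2 <= f x.
  apply: (is_derive_le Nx df) => s /andP[Ns _].
  have s2 : 2 <= s by lra.
  have Nls : N <= s by rewrite (le_trans _ Ns)// le_max lexx.
  have := HN _ Nls; have s0 : 0 <= 2 :> R by [].
  have := grad_increment_le s0 s2; have := grad_increment_le (lexx 0) s0.
  rewrite p0 /f'; nra.
by move: xN; rewrite /f; lra.
Qed.

(* Taylor remainders increase when the interval moves away from 0, because the
   second derivative does. *)
Lemma taylor_left_ge (x d : R) : 0 <= x -> 0 <= d ->
  phi d + phi (x + d) <= d * p (x + d) + phi x.
Proof.
move=> x0 d0.
pose f s := d * p (s + d) + phi s - phi (s + d) - phi d.
have df (s : R) : is_derive s (1 : R) f (d * m (s + d) + p s - p (s + d)).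
  by apply: is_derive_eq; rewrite /GRing.scale /=; ring.
have : f 0 <= f x.
  apply: (is_derive_le x0 df) => s /andP[s0 _].
  by have := @grad_increment_le s (s + d) s0 ltac:(lra); lra.
rewrite /f add0r phi0; have := potential_gap_ge0 d0; lra.
Qed.

Lemma taylor_right_ge (x d : R) : 0 <= x -> 0 <= d ->
  phi d + phi x + d * p x <= phi (x + d).
Proof.
move=> x0 d0.
pose f s := phi (s + d) - phi s - d * p s - phi d.
have df (s : R) : is_derive s (1 : R) f (p (s + d) - p s - d * m s).
  by apply: is_derive_eq; rewrite /GRing.scale /=; ring.
have : f 0 <= f x.
  apply: (is_derive_le x0 df) => s /andP[s0 _].
  by have := @grad_increment_ge s (s + d) s0 ltac:(lra); lra.
by rewrite /f add0r phi0 p0; lra.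
Qed.

(** * Pointwise bounds on the transport cost, without and with a clamp *)

Lemma transport_cost_quadratic (x t y : R) :
  phi x - phi t + (t - x) * (p x - y) <= y ^+ 2 / (2 * l).
Proof.
(* Strong convexity at [x]; the remaining quadratic in [t - x] is bounded by completing the
   square. *)
apply: (@le_trans _ _ (- y * (t - x) - l / 2 * (t - x) ^+ 2)).
  by have := potential_ge_quadratic x t; lra.
rewrite -subr_ge0.
have -> : y ^+ 2 / (2 * l) - (- y * (t - x) - l / 2 * (t - x) ^+ 2) =
  (y + l * (t - x)) ^+ 2 / (2 * l) by field; rewrite gt_eqF.
by rewrite divr_ge0 ?sqr_ge0// mulr_ge0// ltW.
Qed.

(** With [d] the distance from [x] to [t], the Taylor remainder is at least [phi d] on the
    half-line, so the cost is at most [d * |y| - phi d]; [potential_ge_chord] bounds this by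
    [z * |y|]. If [y] and [t - x] have the same sign, the cost is already nonpositive. *)
Lemma transport_cost_same_side (x t y z : R) :
  0 <= x -> 0 <= t -> 0 <= z -> `|y| = 2 * p z ->
  phi x - phi t + (t - x) * (p x - y) <= z * `|y|.
Proof.
move=> x0 t0 z0 yz; rewrite yz.
have Bx : 0 <= phi t - phi x - p x * (t - x).
  have := potential_ge_quadratic x t.
  have : 0 <= l / 2 * (t - x) ^+ 2.
    by rewrite mulr_ge0 ?sqr_ge0// divr_ge0// ltW.
  lra.
have pz0 := grad_ge0 z0.
have zp : 0 <= z * p z by rewrite mulr_ge0.
have [xt|/ltW tx] := leP x t.
  have [y0|/ltW y0] := leP 0 y.
    have : 0 <= y * (t - x) by rewrite mulr_ge0 ?subr_ge0.
    lra.
  have d0 : 0 <= t - x by lra.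
  have := taylor_right_ge x0 d0; have := potential_ge_chord d0 z0.
  have -> : x + (t - x) = t by ring.
  have -> : y = - (2 * p z) by rewrite -yz ler0_norm// opprK.
  nra.
have [y0|/ltW y0] := leP 0 y; last first.
  have : 0 <= y * (t - x) by rewrite mulr_le0 ?subr_le0.
  lra.
have d0 : 0 <= x - t by lra.
have := taylor_left_ge t0 d0; have := potential_ge_chord d0 z0.
have -> : t + (x - t) = x by ring.
have -> : y = 2 * p z by rewrite -yz ger0_norm.
nra.
Qed.

(** Here [t] stands for [T x] and [y] for [g' x]; the logarithm is the price of the clamp. *)
Definition clamped_cost (c x t y : R) : R :=
  phi x - phi t - ln (soft_scale (t - c) ^+ 2) +
  (soft_clamp c t - x) * (p x - y).

Lemma mul_le_sqr (e y : R) : e * y <= y ^+ 2 / (2 * l) + l / 2 * e ^+ 2.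
Proof.
rewrite -subr_ge0.
have -> : y ^+ 2 / (2 * l) + l / 2 * e ^+ 2 - e * y =
  (y - l * e) ^+ 2 / (2 * l) by field; rewrite gt_eqF.
by rewrite divr_ge0 ?sqr_ge0// mulr_ge0// ltW.
Qed.

Lemma clamped_cost_id (c x t y : R) : c <= t ->
  clamped_cost c x t y = phi x - phi t + (t - x) * (p x - y).
Proof.
move=> ct; rewrite /clamped_cost soft_clamp_id// soft_scale_nonneg ?subr_ge0//.
by rewrite expr1n ln1 subr0.
Qed.

Lemma clamped_cost_far : exists2 X, 1 <= X &
  forall x t y, X <= x ->
    clamped_cost 1 x t y <= y ^+ 2 / (2 * l) /\
    (forall z, 0 <= z -> `|y| = 2 * p z -> clamped_cost 1 x t y <= z * `|y|).
Proof.
(* The constant is an upper bound of [- phi t + 2 * (1 - t)], obtained below from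
   [l / 2 * t ^+ 2 <= phi t] by completing the square. *)
have [X X1 HX] := potential_gap_infty
  (2 + 2 / l).
exists X => // x t y Xx; have x0 : 0 <= x by lra.
have [t1|t1] := leP 1 t.
  rewrite clamped_cost_id//; split=> [|z z0 yz].
    exact: transport_cost_quadratic.
  by apply: transport_cost_same_side => //; lra.
have px0 := grad_ge0 x0.
have s0 := soft_clamp_gt 1 t; rewrite subrr in s0.
have s1 := soft_clamp_le (ltW t1).
have lns := ln_soft_scale_ge (ltW t1).
have phit : - phi t + 2 * (1 - t) <= 2 + 2 / l.
  have := potential_ge t.
  have : 0 <= l / 2 * (t + 2 / l) ^+ 2.
    by rewrite mulr_ge0 ?sqr_ge0// divr_ge0// ltW.
  have -> : l / 2 * (t + 2 / l) ^+ 2 = l / 2 * t ^+ 2 + 2 * t + 2 / l.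
    by field; rewrite gt_eqF.
  lra.
(* The gap [x * p x - 2 * phi x] pays for the clamp and for [soft_clamp 1 t * p x <= p x], and still
   leaves [- phi x]. *)
have D : clamped_cost 1 x t y <= - phi x + (x - soft_clamp 1 t) * y.
  have : 0 <= (1 - soft_clamp 1 t) * p x by rewrite mulr_ge0// subr_ge0.
  by have := HX _ Xx; rewrite /clamped_cost; lra.
split=> [|z z0 yz].
  apply: (le_trans D); have := mul_le_sqr (x - soft_clamp 1 t) y.
  have := potential_ge x.
  have : l / 2 * (x - soft_clamp 1 t) ^+ 2 <= l / 2 * x ^+ 2.
    by rewrite ler_wpM2l ?(@divr_ge0 _ l 2) ?(ltW l_gt0)// ler_sqr ?nnegrE; lra.
  lra.
apply: (le_trans D).
have phix0 := potential_ge0 x.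
have [y0|/ltW y0] := leP y 0.
  have : 0 <= z * `|y| by rewrite mulr_ge0.
  have : (x - soft_clamp 1 t) * y <= 0 by rewrite mulr_ge0_le0//; lra.
  lra.
have := potential_ge_chord x0 z0.
have : 0 <= soft_clamp 1 t * y by rewrite mulr_ge0// ltW.
by rewrite yz; move: yz; rewrite ger0_norm// => ->; lra.
Qed.

(** The chord bound at [z = t / 2] gives [t * p (t / 2) <= phi t], and [p] eventually has slope at
    least [4 * K]. *)
Lemma potential_superquadratic (K : R) : 0 < K -> exists2 N, 0 < N &
  forall t, N <= t -> K * t ^+ 2 <= phi t.
Proof.
move=> K0; have [N N0 HN] := m_pinfty (4 * K).
exists (4 * N) => [|t Nt]; first by rewrite mulr_gt0.
have t0 : 0 <= t by lra.
have t20 : 0 <= t / 2 by lra.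
have := potential_ge_chord t0 t20.
have := grad_increment_ge (ltW N0) (_ : N <= t / 2).
move=> /(_ ltac:(lra)).
have := HN _ (lexx N); have := grad_ge0 (ltW N0).
move=> pN mN pt; apply: le_trans.
have -> : 2 * (t - t / 2) * p (t / 2) = t * p (t / 2) by field.
rewrite expr2 mulrCA ler_wpM2l//.
have : 4 * K * (t / 2 - N) <= m N * (t / 2 - N) by rewrite ler_wpM2r//; lra.
have : 0 <= K * (t - 4 * N) by rewrite mulr_ge0 ?subr_ge0// ltW.
lra.
Qed.

Lemma clamped_cost_near (X : R) : 0 <= X -> exists M Z, [/\ 0 <= M, 0 <= Z &
  forall x t y, 0 <= x <= X ->
    clamped_cost (- M) x t y <= y ^+ 2 / (2 * l) /\
    (forall z, Z <= z -> `|y| = 2 * p z ->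
      clamped_cost (- M) x t y <= z * `|y|)].
Proof.
move=> X0.
(* Of this coefficient of [t ^+ 2], the part 2 absorbs the price of the clamp and the part [2 * l]
   absorbs [l / 2 * (2 * t) ^+ 2]. *)
have K0 : 0 < 2 * l + 2 by move: l_gt0; lra.
have [N N0 HN] := potential_superquadratic K0.
(* [M >= X + 1] ensures that a clamped displacement is less than [2 * M], hence than [- 2 * t] when
   [t < - M]. *)
pose M := Num.max N (X + 1).
have NM : N <= M by rewrite le_max lexx.
have XM : X + 1 <= M by rewrite le_max lexx orbT.
(* [X + M + 1] dominates [x - t] for [t >= - M], as well as [x - soft_clamp (- M) t] for every
   [t]. *)
exists M, (X + M + 1); split; [lra|lra|] => x t y /andP[x0 xX].
have px0 := grad_ge0 x0.
have phix : phi x <= x * p x.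
  have := potential_gap_ge0 x0.
  have := potential_ge0 x.
  lra.
have phit0 := potential_ge0 t.
have [Mt|tM] := leP (- M) t.
  rewrite clamped_cost_id//; split=> [|z Zz yz].
    exact: transport_cost_quadratic.
  have z0 : 0 <= z by lra.
  have [t0|t0] := leP 0 t.
    by apply: transport_cost_same_side.
  have : t * p x <= 0 by rewrite mulr_le0_ge0// ltW.
  have : (x - t) * y <= (x - t) * `|y| by rewrite ler_wpM2l ?ler_norm//; lra.
  have : (x - t) * `|y| <= z * `|y| by rewrite ler_wpM2r//; lra.
  lra.
have s0 := soft_clamp_gt (- M) t.
have s1 := soft_clamp_le (ltW tM).
have lns := ln_soft_scale_ge (ltW tM).
have := HN (- t) ltac:(lra); rewrite phi_even sqrrN => phit.
have t1 : 1 <= - t by lra.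
have tt : - t <= t ^+ 2 by nra.
have D : clamped_cost (- M) x t y <=
    - (2 * l * t ^+ 2) + (x - soft_clamp (- M) t) * y.
  have : soft_clamp (- M) t * p x <= 0 by rewrite mulr_le0_ge0//; lra.
  by rewrite /clamped_cost; lra.
split=> [|z Zz yz].
  apply: (le_trans D); have := mul_le_sqr (x - soft_clamp (- M) t) y.
  have : l / 2 * (x - soft_clamp (- M) t) ^+ 2 <= l / 2 * (- 2 * t) ^+ 2.
    by rewrite ler_wpM2l ?(@divr_ge0 _ l 2) ?(ltW l_gt0)// ler_sqr ?nnegrE; lra.
  by rewrite exprMn; lra.
apply: (le_trans D).
have : (x - soft_clamp (- M) t) * y <= (x - soft_clamp (- M) t) * `|y|.
  by rewrite ler_wpM2l ?ler_norm//; lra.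
have : (x - soft_clamp (- M) t) * `|y| <= z * `|y| by rewrite ler_wpM2r//; lra.
have : 0 <= 2 * l * t ^+ 2 by rewrite mulr_ge0 ?sqr_ge0// mulr_ge0// ltW.
lra.
Qed.

End potential.

(** * Cumulative functions and the increasing transport map *)

Lemma integral_le_exhaustion (R : realType) (F : (set R)^nat)
    (f : R -> \bar R) (c : \bar R) :
  nondecreasing_seq F -> (forall n, measurable (F n)) ->
  \bigcup_n F n = setT -> measurable_fun setT f -> (forall x, 0 <= f x)%E ->
  (forall n, \int[mu]_(x in F n) f x <= c)%E -> (\int[mu]_x f x <= c)%E.
Proof.
move=> ndF mF FT mf f0 fc.
have cv : (\int[mu]_(x in F n) f x @[n --> \oo] --> \int[mu]_x f x)%E.
  rewrite -FT; apply: ge0_nondecreasing_set_cvg_integral => // n.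
  exact: measurable_funTS.
rewrite -(cvg_lim _ cv)//.
apply: lime_le; first exact: cvgP cv.
by near=> n; exact: fc.
Unshelve. all: by end_near. Qed.

Section cumulative.
Context (R : realType) (f : R -> R) (I : R).
Hypothesis cf : continuous f.
Hypothesis f_gt0 : forall x, 0 < f x.
Hypothesis f_int : (\int[mu]_x (f x)%:E = I%:E)%E.

Let mf : measurable_fun setT (EFin \o f).
Proof. by apply/measurable_EFinP; exact: continuous_measurable_fun. Qed.

Let f0 (x : R) : (0 <= (f x)%:E)%E.
Proof. by rewrite lee_fin ltW. Qed.

Let f_integrable : mu.-integrable setT (EFin \o f).
Proof.
apply/integrableP; split; first exact: mf.
have -> : (\int[mu]_x `|(EFin \o f) x| = I%:E)%E.
  by rewrite -f_int; apply: eq_integral => x _; rewrite gee0_abs// f0.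
by rewrite ltry.
Qed.

Let f_integrableS (A : set R) : measurable A -> mu.-integrable A (EFin \o f).
Proof. by move=> mA; exact: integrableS f_integrable. Qed.

Let N (x : R) : R := \int[mu]_(t in `]-oo, x]) f t.

Let NE (x : R) : (\int[mu]_(t in `]-oo, x]) (f t)%:E = (N x)%:E)%E.
Proof.
rewrite /N /Rintegral fineK//; apply: integrable_fin_num => //.
exact: f_integrableS.
Qed.

Let dN (x : R) : is_derive x (1 : R) N (f x).
Proof.
have x1 : x < x + 1 by rewrite ltrDl.
have fi : mu.-integrable `]-oo, x + 1] (EFin \o f) by exact: f_integrableS.
have [|] := @continuous_FTC1 R f -oo%O x (x + 1) x1 fi _ (@cf x).
  by rewrite ltNyr.
by move=> dN NE'; apply: DeriveDef => //; rewrite -derive1E.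
Qed.

Let N_lt (x y : R) : x < y -> N x < N y.
Proof.
move=> xy.
have cN : {within `[x, y], continuous N}.
  exact/continuous_subspaceT/is_derive_continuous.
have [c _] := MVT xy (fun x _ => dN x) cN.
by rewrite -subr_gt0 => ->; rewrite mulr_gt0 ?subr_gt0.
Qed.

Let compl (x : R) : (\int[mu]_(t in `]x, +oo[) (f t)%:E = (I - N x)%:E)%E.
Proof.
apply/eqP; rewrite EFinB -f_int -NE -(itv_setU_setT false x).
rewrite integral_setU//=; last 2 first.
  exact: measurable_funTS.
  apply/disj_setPS => z [] /=; rewrite !in_itv/= andbT.
  by move=> /le_lt_trans /[apply]; rewrite ltxx.
by rewrite NE addeAC subee// add0e.
Qed.

Lemma cumulative_exists : exists N : R -> R,
  [/\ forall x, is_derive x (1 : R) N (f x),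
      forall x, 0 < N x < I &
      forall q, 0 < q < I -> exists x, N x = q].
Proof.
have N_ge0 x : 0 <= N x by apply: Rintegral_ge0 => t _; exact: ltW.
have N_leI x : N x <= I.
  rewrite -subr_ge0 -lee_fin -compl; apply: integral_ge0 => t _; exact: f0.
exists N; split => // [x|q /andP[q0 qI]].
  have x1 : x - 1 < x by rewrite ltrBlDr ltrDl.
  have x2 : x < x + 1 by rewrite ltrDl.
  by rewrite (le_lt_trans (N_ge0 _) (N_lt x1)) (lt_le_trans (N_lt x2)).
(* Otherwise exhaustion by the half-lines []-oo, n]] would bound the total mass [I] by [q]. *)
have [b qb] : exists b, q < N b.
  apply: contrapT => /forallNP qN; have : (I%:E <= q%:E)%E.
    rewrite -f_int; apply: (@integral_le_exhaustion R
      (fun n => `]-oo, n%:R]%classic) (EFin \o f)) => //.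
    - move=> m n mn; rewrite subsetEset; apply: subset_itvl.
      by rewrite bnd_simp ler_nat.
    - apply/seteqP; split => // x _; exists (Num.truncn x).+1 => //=.
      by rewrite in_itv/= ltW// truncnS_gt.
    - by move=> n; rewrite NE lee_fin leNgt; exact/negP/qN.
  by rewrite lee_fin leNgt qI.
have [a qa] : exists a, N a < q.
  apply: contrapT => /forallNP qN; have : (I%:E <= (I - q)%:E)%E.
    rewrite -f_int; apply: (@integral_le_exhaustion R
      (fun n => `]- n%:R, +oo[%classic) (EFin \o f)) => //.
    - move=> m n mn; rewrite subsetEset; apply: subset_itvr.
      by rewrite bnd_simp lerN2 ler_nat.
    - apply/seteqP; split => // x _; exists (Num.truncn (- x)).+1 => //=.
      by rewrite in_itv/= andbT ltrNl truncnS_gt.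
    - by move=> n; rewrite compl lee_fin lerB// leNgt; exact/negP/qN.
  by rewrite lee_fin; lra.
have ab : a <= b.
  by rewrite leNgt; apply/negP => /N_lt; lra.
have cN : {within `[a, b], continuous N}.
  exact/continuous_subspaceT/is_derive_continuous.
have [|c _ <-] := @IVT R N a b q ab cN; last by exists c.
by rewrite ge_min le_max (ltW qa) (ltW qb) orbT.
Qed.

End cumulative.

(** The map is the cumulative function of [f] followed by the inverse of that of [h]; equality of
    the masses makes the composition meaningful everywhere. *)
Lemma transport_map_exists (R : realType) (f h : R -> R) (I : R) :
  continuous f -> continuous h ->
  (forall x, 0 < f x) -> (forall x, 0 < h x) ->
  (\int[mu]_x (f x)%:E = I%:E)%E ->
  (\int[mu]_x (h x)%:E = I%:E)%E ->
  exists T : R -> R, forall x, is_derive x (1 : R) T (f x / h (T x)).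
Proof.
move=> cf ch f0 h0 fI hI.
have [N [dN NI _]] := cumulative_exists cf f0 fI.
have [M [dM _ MI]] := cumulative_exists ch h0 hI.
have M_lt (x y : R) : x < y -> M x < M y.
  move=> xy.
  have cM : {within `[x, y], continuous M}.
    exact/continuous_subspaceT/is_derive_continuous.
  have [c _] := MVT xy (fun x _ => dM x) cM.
  by rewrite -subr_gt0 => ->; rewrite mulr_gt0 ?subr_gt0.
have M_inj : injective M.
  move=> x y Mxy; apply/eqP; rewrite eq_le !leNgt; apply/andP.
  by split; apply/negP => /M_lt; rewrite Mxy ltxx.
(* The default 0 is never reached at [N x], which lies strictly between 0 and [I], hence in the
   range of [M]. *)
pose G q := xget 0 [set t | M t = q].
have MG x : M (G (N x)) = N x.
  by have /xgetPex := MI _ (NI x); exact.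
have GK : cancel M G.
  by move=> t; apply: M_inj; apply: (@xgetPex _ _ [set s | M s = M t]); exists t.
exists (G \o N) => x.
have dG : is_derive (M (G (N x))) (1 : R) G (h (G (N x)))^-1.
  apply: (@is_derive_inverse R M G (h (G (N x)))).
  - by near=> t; exact: GK.
  - by near=> t; exact: (is_derive_continuous dM).
  - by rewrite gt_eqF.
rewrite MG in dG; rewrite mulrC.
exact: (is_derive1_comp dG (dN x)).
Unshelve. all: by end_near. Qed.

(** * From bounded intervals with boundary terms to the whole line *)

Section integral_pieces.
Context (R : realType).
Implicit Types (u f : R -> R) (G : R -> \bar R).

Lemma continuous_EFin_measurable f (A : set R) : continuous f ->
  measurable_fun A (EFin \o f).
Proof.
move=> cf; apply/measurable_funTS/measurable_EFinP.
exact: continuous_measurable_fun.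
Qed.

Lemma continuous_integrable_itv f (a b : R) : continuous f ->
  mu.-integrable `]a, b] (EFin \o f).
Proof.
move=> cf; apply: (@integrableS _ _ _ mu `[a, b]) => //.
  by apply: subset_itvr; rewrite bnd_simp.
apply: continuous_compact_integrable; first exact: segment_compact.
exact: continuous_subspaceT.
Qed.

Lemma integral_derive_itv f f' (a b : R) : a < b ->
  (forall x, is_derive x (1 : R) f (f' x)) -> continuous f' ->
  (\int[mu]_(x in `]a, b]) (f' x)%:E = (f b - f a)%:E)%E.
Proof.
move=> ab df cf'; have cf := is_derive_continuous df.
rewrite integral_itv_obnd_cbnd; last exact: (continuous_EFin_measurable cf').
rewrite (@continuous_FTC2 R f' f a b ab)//.
- exact: continuous_subspaceT.
- split => [x _||].
  + exact: ex_derive.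
  + exact/cvg_at_right_filter/cf.
  + exact/cvg_at_left_filter/cf.
- by move=> x _; rewrite derive1E; exact: derive_val.
Qed.

(** The number [k] carries the boundary terms, which add up when adjacent intervals are joined. *)
Definition integral_le_itv u G (a b k : R) :=
  (\int[mu]_(x in `]a, b]) (u x)%:E <= \int[mu]_(x in `]a, b]) G x + k%:E)%E.

Lemma integral_le_itv_derive u f f' G (a b : R) : a < b ->
  continuous u -> (forall x, is_derive x (1 : R) f (f' x)) -> continuous f' ->
  measurable_fun setT G -> (forall x, 0 <= G x)%E ->
  (forall x, a <= x <= b -> ((u x - f' x)%:E <= G x)%E) ->
  integral_le_itv u G a b (f b - f a).
Proof.
move=> ab cu df cf' mG G0 uG; pose v x := u x - f' x.
have cv : continuous v by move=> x; apply: cvgB; [exact: cu|exact: cf'].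
rewrite /integral_le_itv -(integral_derive_itv ab df cf') -leeBlDr; last first.
  exact/integrable_fin_num/continuous_integrable_itv.
rewrite -(integralB_EFin _ (continuous_integrable_itv _ _ cu)
  (continuous_integrable_itv _ _ cf'))//.
rewrite integralE.
(* Passing to the positive part allows the comparison of nonnegative functions, [G] being possibly
   of infinite integral. *)
apply: (@le_trans _ _ (\int[mu]_(x in `]a, b]) (EFin \o v)^\+ x)%E).
  by rewrite -[leRHS]sube0 leeB// integral_ge0.
apply: ge0_le_integral => //.
- by apply: measurable_funepos; exact: continuous_EFin_measurable.
- exact: measurable_funTS.
- move=> x; rewrite /= in_itv/= => /andP[ax xb].
  by rewrite funeposE ge_max G0 uG ?xb ?(ltW ax).
Qed.

Lemma integral_le_itv_cat u G (a b c k l : R) : a <= b -> b <= c ->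
  continuous u -> measurable_fun setT G -> (forall x, 0 <= G x)%E ->
  integral_le_itv u G a b k -> integral_le_itv u G b c l ->
  integral_le_itv u G a c (k + l).
Proof.
move=> ab bc cu mG G0 ukab ulbc; rewrite /integral_le_itv.
have -> : `]a, c]%classic = `]a, b]%classic `|` `]b, c]%classic.
  by apply: itv_bndbnd_setU; rewrite bnd_simp.
have dis : [disjoint `]a, b]%classic & `]b, c]%classic].
  apply/disj_setPS => z [] /=; rewrite !in_itv/= => /andP[_ zb] /andP[bz _].
  by move: (lt_le_trans bz zb); rewrite ltxx.
have mfu A : measurable_fun A (EFin \o u) by exact: continuous_EFin_measurable.
have mG' A : measurable_fun A G by exact: measurable_funTS.
rewrite (@integral_setU _ _ _ mu _ _ (EFin \o u))//; last exact: mfu.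
rewrite (@integral_setU _ _ _ mu _ _ G)//; last exact: mG'.
by rewrite EFinD [leRHS]addeACA; exact: leeD.
Qed.

(** Moving the integrable negative part of [u] to the right makes all integrands nonnegative;
    monotone convergence then applies, and the boundary error [e] is arbitrary. *)
Lemma integral_le_of_itv u G : continuous u ->
  measurable_fun setT G -> (forall x, 0 <= G x)%E ->
  (\int[mu]_x (EFin \o u)^\- x < +oo)%E ->
  (forall N e : R, 0 < e -> exists a b, [/\ a <= - N, N <= b &
    integral_le_itv u G a b e]) ->
  (\int[mu]_x (u x)%:E <= \int[mu]_x G x)%E.
Proof.
move=> cu mG G0 un uG; apply/lee_addgt0Pr => e e0.
have mfu A : measurable_fun A (EFin \o u) by exact: continuous_EFin_measurable.
have uE A : (\int[mu]_(x in A) (u x)%:E =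
    \int[mu]_(x in A) (EFin \o u)^\+ x - \int[mu]_(x in A) (EFin \o u)^\- x)%E.
  exact: integralE.
have un_fin : (\int[mu]_x (EFin \o u)^\- x)%E \is a fin_num.
  by rewrite ge0_fin_numE// integral_ge0.
rewrite uE (leeBlDr _ _ un_fin).
apply: (@integral_le_exhaustion R (fun n => `]- n%:R, n%:R]%classic)) => //.
- move=> m n mn; rewrite subsetEset; apply: subset_itv.
    by rewrite bnd_simp lerN2 ler_nat.
  by rewrite bnd_simp ler_nat.
- exact: bigcup_itvT.
- by apply: measurable_funepos; exact: mfu.
move=> n; have [a [b [an nb]]] := uG n%:R _ e0; rewrite /integral_le_itv => uGab.
have fin_ab : (\int[mu]_(x in `]a, b]) (EFin \o u)^\- x)%E \is a fin_num.
  rewrite ge0_fin_numE ?integral_ge0//; apply: le_lt_trans un.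
  by apply: ge0_subset_integral => //; apply: measurable_funeneg; exact: mfu.
apply: (@le_trans _ _ (\int[mu]_(x in `]a, b]) (EFin \o u)^\+ x)%E).
  apply: ge0_subset_integral => //; first by apply: measurable_funepos; exact: mfu.
  by apply: subset_itv; rewrite bnd_simp.
move: uGab; rewrite uE (leeBlDr _ _ fin_ab).
move=> /le_trans; apply.
apply: leeD; first apply: leeD => //.
  exact: ge0_subset_integral.
by apply: ge0_subset_integral => //; apply: measurable_funeneg; exact: mfu.
Qed.

End integral_pieces.

(* The left-hand side is dominated by K (atan \o T)', which is integrable. *)
Lemma flux_small (R : realType) (T T' w : R -> R) (K : R) : 0 <= K ->
  (forall x, is_derive x (1 : R) T (T' x)) ->
  (forall x, w x <= K * (T' x / (1 + T x ^+ 2))) ->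
  forall b e : R, 0 < e -> exists2 c, b <= c & w c <= e.
Proof.
move=> K0 dT wT b e e0; apply: contrapT => H.
have we x : b <= x -> e < w x.
  by move=> bx; rewrite ltNge; apply/negP => wx; apply: H; exists x.
pose G x := K * atan (T x) - e * x.
have dG (x : R) : is_derive x (1 : R) G (K * (T' x / (1 + T x ^+ 2)) - e).
  have dat := @is_derive1_comp R atan T x _ _ (is_derive1_atan _) (dT x).
  have dK := is_deriveM (is_derive_cst K x 1) dat.
  have dx : is_derive x (1 : R) (fun x => e * x) e.
    by apply: is_derive_eq; rewrite /GRing.scale /=; ring.
  apply: (is_derive_eq (is_deriveB dK dx)).
  by rewrite /GRing.scale /=; ring.
(* If [w > e] beyond [b], then [G] is nondecreasing there; but over this length [e * x] gains
   [K * pi + 1], more than [K * atan] can. *)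
pose t := (K * pi + 1) / e.
have t0 : 0 <= t by rewrite divr_ge0 ?addr_ge0 ?mulr_ge0 ?pi_ge0// ltW.
have bt : b <= b + t by rewrite lerDl.
have : G b <= G (b + t).
  apply: (is_derive_le bt dG) => x /andP[bx _].
  by have := we _ bx; have := wT x; lra.
have et : e * t = K * pi + 1 by rewrite /t mulrC divfK// gt_eqF.
have : K * atan (T (b + t)) <= K * (pi / 2).
  by rewrite ler_wpM2l// ltW// atan_ltpi2.
have : K * (- (pi / 2)) <= K * atan (T b).
  by rewrite ler_wpM2l// ltW// atan_gtNpi2.
by rewrite /G mulrDr et; lra.
Qed.

(** * Measurability and lower bounds for [H_fun] *)

Section H_fun_facts.
Context (R : realType) (phi : R -> R) (A l C : R).
Hypothesis phi0 : phi 0 = 0.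
Hypothesis phi_even : forall x, phi (- x) = phi x.
Hypothesis A_gt1 : 1 < A.
Hypothesis l_gt0 : 0 < l.

Lemma fenchel_ge (x z : R) : ((x * z - phi z)%:E <= fenchel phi x)%E.
Proof. by apply: ereal_sup_ubound; exists z. Qed.

Lemma fenchel_ge0 (x : R) : (0 <= fenchel phi x)%E.
Proof. by have := fenchel_ge x 0; rewrite mulr0 phi0 subrr. Qed.

Lemma fenchel_even (x : R) : fenchel phi (- x) = fenchel phi x.
Proof.
rewrite /fenchel; congr ereal_sup; apply/seteqP; split=> _ [z _ <-];
  by exists (- z) => //; rewrite phi_even mulrNN || rewrite phi_even mulrN mulNr.
Qed.

(** A supremum of affine functions is lower semicontinuous. *)
Lemma measurable_fenchel : measurable_fun setT (fenchel phi).
Proof.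
apply: lower_semicontinuous_measurable; apply/lower_semicontinuousP => a.
rewrite [X in open X](_ : _ =
    \bigcup_z [set x | a < x * z - phi z]); last first.
  apply/seteqP; split=> x /=.
    by move=> /ereal_sup_gt[_ [z _ <-]]; rewrite lte_fin => az; exists z.
  move=> [z _ /= az]; apply: lt_le_trans (fenchel_ge x z).
  by rewrite lte_fin.
apply: bigcup_open => z _.
rewrite [X in open X](_ : _ = (fun x => x * z - phi z) @^-1` [set y | a < y])//.
apply: open_comp; last exact: open_gt.
move=> x _; apply: cvgB; last exact: cvg_cst.
by apply: cvgM; [exact: cvg_id|exact: cvg_cst].
Qed.

Lemma measurable_H_fun : measurable_fun setT (H_fun phi A l C).
Proof.
apply: measurable_fun_ifT.
- by apply: measurable_fun_ltr => //; exact: normr_measurable.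
- apply: emeasurable_funM; first exact: measurable_cst.
  apply: (@measurableT_comp _ _ _ _ _ _ (fenchel phi)).
    exact: measurable_fenchel.
  by apply: measurable_funM => //; exact: measurable_cst.
- by apply/measurable_EFinP; apply: measurable_funM.
Qed.

Lemma H_fun_ge0 (y : R) : (0 <= H_fun phi A l C y)%E.
Proof.
have A1 := A_gt1; rewrite /H_fun; case: ifP => _.
  rewrite mule_ge0 ?fenchel_ge0// lee_fin divr_ge0//; lra.
by rewrite lee_fin mulr_ge0 ?sqr_ge0// invr_ge0 mulr_ge0// ltW.
Qed.

Lemma H_fun_even (y : R) : H_fun phi A l C (- y) = H_fun phi A l C y.
Proof. by rewrite /H_fun normrN mulNr fenchel_even sqrrN. Qed.

(** Testing the supremum at [z] gives at least [z * p - phi z >= (1 - A^-1) * (z * p)]; the factor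
    [2 * A / (A - 1)] turns this into [2 * z * p]. *)
Lemma H_fun_ge_linear (p z y : R) : 0 <= z -> A * phi z <= z * p ->
  C < `|y| -> `|y| = 2 * p -> ((z * `|y|)%:E <= H_fun phi A l C y)%E.
Proof.
move=> z0 Az Cy yp; rewrite /H_fun Cy.
have A1 : 0 < A - 1 by rewrite subr_gt0.
have fz : ((z * p - phi z)%:E <= fenchel phi (y / 2))%E.
  have [y0|/ltW y0] := leP 0 y.
    rewrite ger0_norm// in yp; have -> : z * p = y / 2 * z by rewrite yp; field.
    exact: fenchel_ge.
  rewrite ler0_norm// in yp; rewrite -fenchel_even -mulNr yp.
  have -> : z * p = 2 * p / 2 * z by field.
  exact: fenchel_ge.
have c0 : 0 <= 2 * A / (A - 1) by rewrite divr_ge0//; move: A_gt1; lra.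
apply: (@le_trans _ _ ((2 * A / (A - 1))%:E * (z * p - phi z)%:E)%E); last first.
  by rewrite lee_wpmul2l// lee_fin.
rewrite -EFinM lee_fin yp -subr_ge0.
have -> : 2 * A / (A - 1) * (z * p - phi z) - z * (2 * p) =
  2 / (A - 1) * (z * p - A * phi z) by field; rewrite gt_eqF.
by rewrite mulr_ge0 ?subr_ge0// divr_ge0// ltW.
Qed.

End H_fun_facts.

(** * Integration by parts along the transport map *)

Section transport_inequality.
Context (R : realType) (phi p g g' T : R -> R) (m0 : R) (H : R -> \bar R).
Hypothesis dphi : forall x, is_derive x (1 : R) phi (p x).
Hypothesis dg : forall x, is_derive x (1 : R) g (g' x).
Hypothesis cp : continuous p.
Hypothesis cg' : continuous g'.
Hypothesis m0_gt0 : 0 < m0.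
Hypothesis mH : measurable_fun setT H.
Hypothesis H0 : forall y, (0 <= H y)%E.

(** [F] is the density of [e^g mu_phi], of mass [m0] in the application; [dT] is the derivative that
    conservation of mass imposes on the transport map. *)
Let F x := expR (g x) * expR (- phi x).
Let dT x := F x / (m0 * expR (- phi (T x))).
Hypothesis T_derive : forall x, is_derive x (1 : R) T (dT x).

Let u x := F x * (g x - ln m0).
Let G x := (H (g' x) * (F x)%:E)%E.

Let F_gt0 x : 0 < F x.
Proof. by rewrite mulr_gt0 ?expR_gt0. Qed.

Let dT_gt0 x : 0 < dT x.
Proof. by rewrite divr_gt0// mulr_gt0// expR_gt0. Qed.

(** The logarithm of the transport equation, which relates the factor [g x - ln m0] of [u] to
    [phi x - phi (T x) + ln T']. *)
Let ln_dT x : ln (dT x) = g x - phi x - ln m0 + phi (T x).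
Proof.
rewrite /dT /F ln_div ?posrE ?mulr_gt0 ?expR_gt0//.
by rewrite !lnM ?posrE ?expR_gt0// !expRK; ring.
Qed.

Let dF x : is_derive x (1 : R) F (F x * (g' x - p x)).
Proof.
have de := @is_derive1_comp R expR g x _ _ (is_derive_expR (g x)) (dg x).
have dN : is_derive x (1 : R) (fun x => - phi x) (- p x).
  exact: (is_deriveN (dphi x)).
have dep := @is_derive1_comp R expR (fun x => - phi x) x _ _ (is_derive_expR _) dN.
apply: (is_derive_eq (is_deriveM de dep)).
by rewrite /GRing.scale /= /F; ring.
Qed.

Let cF : continuous F.
Proof. exact: is_derive_continuous dF. Qed.

Let cg : continuous g.
Proof. exact: is_derive_continuous dg. Qed.

Let cphi : continuous phi.
Proof. exact: is_derive_continuous dphi. Qed.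

Let cT : continuous T.
Proof. exact: is_derive_continuous T_derive. Qed.

Let cdT : continuous dT.
Proof.
move=> x; apply: cvgM; first exact: cF.
apply: cvgV; first by rewrite gt_eqF// mulr_gt0 ?expR_gt0.
apply: cvgM; first exact: cvg_cst.
apply: (@continuous_comp _ _ _ (fun x => - phi (T x)) expR).
  by apply: cvgN; apply: (@continuous_comp _ _ _ T phi); [exact: cT|exact: cphi].
exact: continuous_expR.
Qed.

Let cu : continuous u.
Proof.
move=> x; apply: cvgM; first exact: cF.
by apply: cvgB; [exact: cg|exact: cvg_cst].
Qed.

Let mG : measurable_fun setT G.
Proof.
apply: emeasurable_funM.
  apply: (@measurableT_comp _ _ _ _ _ _ H _ g') => //.
  exact: continuous_measurable_fun.
by apply/measurable_EFinP; exact: continuous_measurable_fun.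
Qed.

Let G0 x : (0 <= G x)%E.
Proof. by rewrite mule_ge0// lee_fin ltW. Qed.

(* Integration by parts on [a, b], with the displacement measured by s (T x)
   instead of T x: this loosens the inequality ln T' <= T' - 1, used in the form
   ln (s' T') <= s' T' - 1, only where s is not the identity. *)
Lemma transport_on_itv (s s' : R -> R) (a b : R) : a < b ->
  (forall t, is_derive t (1 : R) s (s' t)) -> continuous s' ->
  (forall t, 0 < s' t) ->
  (forall x, a <= x <= b -> ((phi x - phi (T x) - ln (s' (T x)) +
    (s (T x) - x) * (p x - g' x))%:E <= H (g' x))%E) ->
  integral_le_itv u G a b ((s (T b) - b) * F b - (s (T a) - a) * F a).
Proof.
move=> ab ds cs' s'0 cost.
pose f x := (s (T x) - x) * F x.
pose f' x := (s' (T x) * dT x - 1) * F x +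
  (s (T x) - x) * (F x * (g' x - p x)).
have cs := is_derive_continuous ds.
have df (x : R) : is_derive x (1 : R) f (f' x).
  have d1 := @is_derive1_comp R s T x _ _ (ds (T x)) (T_derive x).
  have d2 := is_deriveM (is_deriveB d1 (is_derive_id x (1 : R))) (dF x).
  apply: (is_derive_eq d2).
  by rewrite /GRing.scale /= !fctE /f'; ring.
have csT x : {for x, continuous (fun x => s (T x))}.
  by apply: (@continuous_comp _ _ _ T s); [exact: cT|exact: cs].
have cs'T x : {for x, continuous (fun x => s' (T x))}.
  by apply: (@continuous_comp _ _ _ T s'); [exact: cT|exact: cs'].
have cf' : continuous f'.
  move=> x; apply: cvgD; apply: cvgM.
  - apply: cvgB; last exact: cvg_cst.
    by apply: cvgM; [exact: cs'T|exact: cdT].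
  - exact: cF.
  - by apply: cvgB; [exact: csT|exact: cvg_id].
  - apply: cvgM; first exact: cF.
    by apply: cvgB; [exact: cg'|exact: cp].
apply: (integral_le_itv_derive ab cu df cf' mG G0) => x xab.
apply: le_trans (_ : ((phi x - phi (T x) - ln (s' (T x)) +
    (s (T x) - x) * (p x - g' x))%:E * (F x)%:E <= _)%E); last first.
  by apply: lee_wpmul2r; [rewrite lee_fin ltW|exact: cost].
rewrite -EFinM lee_fin.
have lnsT : ln (s' (T x)) + ln (dT x) <= s' (T x) * dT x - 1.
  rewrite -lnM ?posrE//; have sd0 : 0 < s' (T x) * dT x by rewrite mulr_gt0.
  by have := @le_ln1Dx R (s' (T x) * dT x - 1) ltac:(lra); rewrite subrKC.
rewrite ln_dT in lnsT.
(* All that remains is [F x] times the slack in [ln (s' T') <= s' T' - 1]. *)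
rewrite -subr_ge0 [leRHS](_ : _ = F x * (s' (T x) * dT x - 1 -
  (ln (s' (T x)) + (g x - phi x - ln m0 + phi (T x))))).
  by rewrite mulr_ge0 ?subr_ge0// ltW.
by rewrite /u /f'; ring.
Qed.

Lemma continuous_soft_clamp_derive (c : R) :
  continuous (fun t => soft_scale (t - c) ^+ 2).
Proof.
move=> t; have ct : {for t, continuous (fun t => soft_scale (t - c))}.
  apply: (@continuous_comp _ _ _ (fun t => t - c) (@soft_scale R)).
    by apply: cvgB; [exact: cvg_id|exact: cvg_cst].
  exact: continuous_soft_scale.
by apply: cvgM; exact: ct.
Qed.

Let flux_right c x := (soft_clamp c (T x) - x) * F x.
Let flux_left c x := (- soft_clamp c (- T x) - x) * F x.

Hypothesis phi_even : forall x, phi (- x) = phi x.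
Hypothesis p_odd : forall x, p (- x) = - p x.
Hypothesis H_even : forall y, H (- y) = H y.

Let right_piece (c a b : R) : a < b ->
  (forall x t y, a <= x <= b -> ((clamped_cost phi p c x t y)%:E <= H y)%E) ->
  integral_le_itv u G a b (flux_right c b - flux_right c a).
Proof.
move=> ab cost.
apply: (transport_on_itv ab (@is_derive_soft_clamp R c)).
- exact: continuous_soft_clamp_derive.
- by move=> t; rewrite exprn_gt0// soft_scale_gt0.
- by move=> x xab; exact: cost.
Qed.

(** Mirror image of [right_piece]: the cost bound is used at [- x], [- T x] and [- g' x], thanks to
    the parity of [phi], [p] and [H]. *)
Let left_piece (c a b : R) : b < a ->
  (forall x t y, b <= x <= a -> ((clamped_cost phi p c x t y)%:E <= H y)%E) ->
  integral_le_itv u G (- a) (- b) (flux_left c (- b) - flux_left c (- a)).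
Proof.
move=> ba cost.
pose s t : R := - soft_clamp c (- t).
pose s' t : R := soft_scale (- t - c) ^+ 2.
have ds t : is_derive t (1 : R) s (s' t).
  have dN : is_derive t (1 : R) (fun t : R => - t) (- 1).
    exact: (is_deriveN (is_derive_id t (1 : R))).
  have dc := @is_derive1_comp R (soft_clamp c) (fun t => - t) t _ _
    (is_derive_soft_clamp c (- t)) dN.
  by apply: (is_derive_eq (is_deriveN dc)); rewrite mulrN1 opprK.
have cs' : continuous s'.
  move=> t; apply: (@continuous_comp _ _ _ (fun t : R => - t)
    (fun t => soft_scale (t - c) ^+ 2)).
    exact: (cvgN cvg_id).
  exact: continuous_soft_clamp_derive.
apply: (transport_on_itv (s := s) (s' := s')) => //.
- by rewrite ltrN2.
- by move=> t; rewrite exprn_gt0// soft_scale_gt0.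
move=> x /andP[ax xb]; rewrite -H_even.
apply: le_trans (cost (- x) (- T x) (- g' x) _).
  rewrite lee_fin /clamped_cost !phi_even p_odd /s /s'.
  by rewrite -mulrNN !opprD !opprK.
by rewrite lerNr xb lerNl ax.
Qed.

Hypothesis int_mu : (\int[mu]_x (expR (- phi x))%:E = 1)%E.

(** From [ln r <= r - 1] with [r = m0 / e^g] follows [e^g * (ln m0 - g) <= m0], so the negative part
    of [u] is at most [m0 * e^(- phi)]. *)
Let u_neg_lty : (\int[mu]_x (EFin \o u)^\- x < +oo)%E.
Proof.
have mexp : measurable_fun setT (fun x => (expR (- phi x))%:E).
  apply/measurable_EFinP; apply: continuous_measurable_fun => x.
  apply: (@continuous_comp _ _ _ (fun x => - phi x) expR).
    by apply: cvgN; exact: cphi.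
  exact: continuous_expR.
apply: (@le_lt_trans _ _ (\int[mu]_x (m0%:E * (expR (- phi x))%:E))%E).
  apply: ge0_le_integral => //.
  - by apply: measurable_funeneg; exact: continuous_EFin_measurable.
  - exact: emeasurable_funM.
  move=> x _; rewrite funenegE ge_max /= -?EFinN -EFinM !lee_fin.
  rewrite [X in _ && X]mulr_ge0 ?expR_ge0 ?(ltW m0_gt0)// andbT.
  have r0 : 0 < expR (g x) / m0 by rewrite divr_gt0 ?expR_gt0.
  have lnr : g x - ln m0 = ln (expR (g x) / m0).
    by rewrite ln_div ?posrE ?expR_gt0// expRK.
  have : ln (m0 / expR (g x)) <= m0 / expR (g x) - 1.
    have r1 : 0 < m0 / expR (g x) by rewrite divr_gt0 ?expR_gt0.
    by have := @le_ln1Dx R (m0 / expR (g x) - 1) ltac:(lra); rewrite subrKC.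
  rewrite ln_div ?posrE ?expR_gt0// expRK => lnm.
  have : expR (g x) * (ln m0 - g x) <= m0.
    apply: (@le_trans _ _ (expR (g x) * (m0 / expR (g x)))).
      by rewrite ler_wpM2l ?expR_ge0//; lra.
    by rewrite mulrC divfK// gt_eqF ?expR_gt0.
  move=> /(ler_wpM2r (expR_ge0 (- phi x))).
  by rewrite /u /F; lra.
have m0_ge0 : (0 <= m0%:E)%E by rewrite lee_fin ltW.
have e_ge0 (x : R) : [set: R] x -> (0 <= (expR (- phi x))%:E)%E.
  by rewrite lee_fin expR_ge0.
have -> : (\int[mu]_x (m0%:E * (expR (- phi x))%:E) = m0%:E)%E.
  by rewrite -[RHS]mule1 -int_mu; apply: ge0_integralZl.
by rewrite ltry.
Qed.

Lemma transport_inequality (X M K : R) : 0 < X -> 0 <= M -> 0 <= K ->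
  (forall x t y, X <= x -> ((clamped_cost phi p 1 x t y)%:E <= H y)%E) ->
  (forall x t y, 0 <= x <= X ->
    ((clamped_cost phi p (- M) x t y)%:E <= H y)%E) ->
  (forall t, soft_clamp 1 t * expR (- phi t) <= K / (1 + t ^+ 2)) ->
  (\int[mu]_x (u x)%:E <= \int[mu]_x G x)%E.
Proof.
move=> X0 M0 K0 far near decay.
apply: (integral_le_of_itv cu mG G0 u_neg_lty) => N e e0.
(* In this form [decay] bounds [soft_clamp 1 (T x) * F x] by [m0 * K * T' / (1 + T ^+ 2)], as
   [flux_small] requires. *)
have FE x : F x = m0 * expR (- phi (T x)) * dT x.
  by rewrite /dT mulrC divfK// gt_eqF// mulr_gt0 ?expR_gt0.
have mK : 0 <= m0 * K by rewrite mulr_ge0// ltW.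
have e2 : 0 < e / 2 by rewrite divr_gt0.
(* The other part of the flux, [- b * F b], has the right sign since [b > 0]. *)
have [b Nb wb] : exists2 b, Num.max N (X + 1) <= b &
    soft_clamp 1 (T b) * F b <= e / 2.
  apply: (flux_small mK T_derive _ _ e2) => x.
  rewrite FE -subr_ge0.
  rewrite [leRHS](_ : _ = m0 * dT x * (K / (1 + T x ^+ 2) -
    soft_clamp 1 (T x) * expR (- phi (T x)))); last by ring.
  by rewrite mulr_ge0 ?subr_ge0// ltW// mulr_gt0.
have [a Na wa] : exists2 a, Num.max N (X + 1) <= a &
    soft_clamp 1 (- T (- a)) * F (- a) <= e / 2.
  have dTN (x : R) : is_derive x (1 : R) (fun x => - T (- x)) (dT (- x)).
    have dN : is_derive x (1 : R) (fun x : R => - x) (- 1).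
      exact: (is_deriveN (is_derive_id x (1 : R))).
    have dc := @is_derive1_comp R T (fun x => - x) x _ _ (T_derive (- x)) dN.
    by apply: (is_derive_eq (is_deriveN dc)); rewrite mulrN1 opprK.
  apply: (flux_small mK dTN _ _ e2) => x.
  rewrite FE -subr_ge0 -[phi (T _)]phi_even.
  rewrite [leRHS](_ : _ = m0 * dT (- x) * (K / (1 + (- T (- x)) ^+ 2) -
    soft_clamp 1 (- T (- x)) * expR (- phi (- T (- x))))); last by ring.
  by rewrite mulr_ge0 ?subr_ge0// ltW// mulr_gt0.
move: Nb Na; rewrite !ge_max => /andP[Nb Xb] /andP[Na Xa].
exists (- a), b; split => //; first by rewrite lerN2.
have p1 : integral_le_itv u G (- a) (- X) (flux_left 1 (- X) - flux_left 1 (- a)).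
  by apply: left_piece => [|x t y /andP[xX _]]; [lra|exact: far].
have p2 : integral_le_itv u G (- X) 0 (flux_left (- M) 0 - flux_left (- M) (- X)).
  by rewrite -oppr0; apply: left_piece => // x t y xX; exact: near.
have p3 : integral_le_itv u G 0 X (flux_right (- M) X - flux_right (- M) 0).
  by apply: right_piece => // x t y xX; exact: near.
have p4 : integral_le_itv u G X b (flux_right 1 b - flux_right 1 X).
  by apply: right_piece => [|x t y /andP[xX _]]; [lra|exact: far].
have X1 : - a <= - X by lra.
have X2 : - X <= 0 by lra.
have X3 : X <= b by lra.
have p12 := integral_le_itv_cat X1 X2 cu mG G0 p1 p2.
have p34 := integral_le_itv_cat (ltW X0) X3 cu mG G0 p3 p4.
have a0 : - a <= 0 by lra.
have b0 : 0 <= b by lra.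
have := integral_le_itv_cat a0 b0 cu mG G0 p12 p34.
rewrite /integral_le_itv => /le_trans; apply; rewrite leeD2l// lee_fin.
have Mle1 : - M <= 1 by lra.
(* The junctions: at [X] and [- X] the clamp levels are compared, at 0 both clamps are compared with
   [T 0], and the two outer fluxes cost [e / 2] each. *)
have j1 : flux_left 1 (- X) <= flux_left (- M) (- X).
  by rewrite ler_wpM2r ?(ltW (F_gt0 _))// lerD2r lerN2 soft_clamp_le_level.
have j2 : flux_left (- M) 0 <= flux_right (- M) 0.
  rewrite ler_wpM2r ?(ltW (F_gt0 _))// lerD2r.
  have := soft_clamp_ge (- M) (T 0); have := soft_clamp_ge (- M) (- T 0); lra.
have j3 : flux_right (- M) X <= flux_right 1 X.
  by rewrite ler_wpM2r ?(ltW (F_gt0 _))// lerD2r soft_clamp_le_level.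
have j4 : flux_right 1 b <= e / 2.
  apply: le_trans wb; rewrite ler_wpM2r ?(ltW (F_gt0 _))//; lra.
have j5 : - flux_left 1 (- a) <= e / 2.
  apply: le_trans wa; rewrite -mulNr ler_wpM2r ?(ltW (F_gt0 _))//; lra.
lra.
Qed.

End transport_inequality.

(** The choice of [c] gives [c * (1 + t ^+ 2) <= 1 + phi t / 2 <= e^(phi t / 2)]. After squaring,
    one factor [1 + t ^+ 2] beats the clamp and the other is the required decay. *)
Lemma soft_clamp_decay (R : realType) (phi : R -> R) (l : R) : 0 < l ->
  (forall t, l / 2 * t ^+ 2 <= phi t) ->
  exists2 K, 0 <= K &
    forall t, soft_clamp 1 t * expR (- phi t) <= K / (1 + t ^+ 2).
Proof.
move=> l0 phi_ge; pose c := Num.min 1 (l / 4).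
have c0 : 0 < c by rewrite lt_min ltr01 divr_gt0.
exists (c ^- 2) => [|t]; first by rewrite invr_ge0 sqr_ge0.
have t2 := sqr_ge0 t; have t1 : 0 < 1 + t ^+ 2 by lra.
have sct : soft_clamp 1 t <= 1 + t ^+ 2.
  have [t1'|/ltW/soft_clamp_le] := leP 1 t; last by lra.
  by rewrite soft_clamp_id//; nra.
have ct : c * (1 + t ^+ 2) <= expR (phi t / 2).
  apply: le_trans (expR_ge1Dx _).
  have c1 : c <= 1 by rewrite ge_min lexx.
  have cl : c * t ^+ 2 <= l / 4 * t ^+ 2.
    by rewrite ler_wpM2r// ge_min lexx orbT.
  by have := phi_ge t; lra.
rewrite ler_pdivlMr// expRN mulrAC ler_pdivrMr ?expR_gt0//.
apply: (@le_trans _ _ ((1 + t ^+ 2) ^+ 2)).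
  by rewrite expr2 ler_wpM2r// ltW.
rewrite ler_pdivlMl ?exprn_gt0// -exprMn.
have -> : expR (phi t) = expR (phi t / 2) ^+ 2.
  by rewrite expr2 -expRD; congr expR; field.
by rewrite ler_sqr ?nnegrE ?expR_ge0// mulr_ge0// ltW.
Qed.

(** * Translation of the hypotheses and proof of the theorem *)

Lemma is_derive_derive1 (R : realType) (f : R -> R) :
  (forall x, derivable f x 1) -> forall x, is_derive x (1 : R) f (derive1 f x).
Proof. by move=> df x; apply: DeriveDef; rewrite ?derive1E. Qed.

Lemma derive1_even (R : realType) (f : R -> R) :
  (forall x, derivable f x 1) -> (forall x, f (- x) = f x) ->
  forall x, derive1 f (- x) = - derive1 f x.
Proof.
move=> df fe x; have dfx := is_derive_derive1 df.
have dN : is_derive x (1 : R) (fun x : R => - x) (- 1).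
  exact: (is_deriveN (is_derive_id x (1 : R))).
have := @is_derive1_comp R f (fun x => - x) x _ _ (dfx (- x)) dN.
have -> : f \o (fun x => - x) = f by apply/funext => z; exact: fe.
move=> [_]; have [_ ->] := dfx x.
by move=> ->; rewrite mulrN1 opprK.
Qed.

Lemma pinftyP (R : realType) (f : R -> R) : f x @[x --> +oo] --> +oo ->
  forall K, exists2 N, 0 < N & forall x, N <= x -> K <= f x.
Proof.
move=> /cvgryPge fK K; have [N [_ HN]] := fK K.
exists (Num.max N 0 + 1) => [|x].
  by rewrite ltr_wpDl// le_max lexx orbT.
move=> Nx; apply: HN; apply: lt_le_trans Nx.
by rewrite ltr_pwDr// le_max lexx.
Qed.

Theorem theorem3p1 (R : realType) (phi : R -> R) (A lambda : R)
  (phiC2 : C2_fun phi)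
  (phi_cvx : strictly_convex phi)
  (phi_pinfty : phi x / `|x| @[x --> +oo] --> +oo)
  (phi_ninfty : phi x / `|x| @[x --> -oo] --> +oo)
  (phi_prob : muint phi (fun=> 1%E) = 1%E)
  (phi_int : integrability_condition phi)
  (phi_even : forall x, phi (- x) = phi x)
  (phi0 : phi 0 = 0)
  (phi2_decr : forall x y, x <= y -> y <= 0 -> derive1 (derive1 phi) y <= derive1 (derive1 phi) x)
  (phi2_incr : forall x y, 0 <= x -> x <= y -> derive1 (derive1 phi) x <= derive1 (derive1 phi) y)
  (phi2_ge : forall x, derive1 (derive1 phi) 0 <= derive1 (derive1 phi) x)
  (phi2_0 : derive1 (derive1 phi) 0 = lambda)
  (lambda_gt0 : 0 < lambda)
  (phi2_pinfty : derive1 (derive1 phi) x @[x --> +oo] --> +oo)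
  (phi2_ninfty : derive1 (derive1 phi) x @[x --> -oo] --> +oo)
  (A_gt1 : 1 < A)
  (phi_growth : exists C0 : R, 0 < C0 /\
     forall x, C0 <= `|x| -> A * phi x <= x * derive1 phi x) :
  exists C : R, 0 < C /\
    forall g : R -> R, C1_fun g ->
      (muint phi (fun x => (expR (g x))%:E) < +oo)%E ->
      (Ent phi g <=
         muint phi (fun x => H_fun phi A lambda C (derive1 g x) * (expR (g x))%:E))%E.
Proof.
have [dphi' [dp' cm]] := phiC2.
set p := derive1 phi in dp' cm phi2_decr phi2_incr phi2_ge phi2_0 phi2_pinfty
  phi2_ninfty phi_growth *.
set m := derive1 p in cm phi2_decr phi2_incr phi2_ge phi2_0 phi2_pinfty
  phi2_ninfty.
have dphi := is_derive_derive1 dphi'; have dp := is_derive_derive1 dp'.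
rewrite -/p in dphi; rewrite -/m in dp.
have cphi := is_derive_continuous dphi; have cp := is_derive_continuous dp.
have p_odd : forall x, p (- x) = - p x by exact: derive1_even.
have p0 : p 0 = 0 by have := p_odd 0; rewrite oppr0; lra.
have m_ge x : lambda <= m x by rewrite -phi2_0.
have m_pinfty := pinftyP phi2_pinfty.
have phi_ge := potential_ge dphi dp phi0 p0 m_ge.
have [X X1 far] := clamped_cost_far dphi dp phi0 p0 lambda_gt0 m_ge phi2_incr
  m_pinfty.
have X0 : 0 < X by lra.
have [M [Z [M0 Z0 near]]] := clamped_cost_near dphi dp phi0 p0 phi_even
  lambda_gt0 m_ge phi2_incr m_pinfty (ltW X0).
have [K K0 decay] := soft_clamp_decay lambda_gt0 phi_ge.
have [C0 [C0_gt0 growth]] := phi_growth.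
pose Z1 := Num.max Z C0.
have ZZ1 : Z <= Z1 by rewrite le_max lexx.
have CZ1 : C0 <= Z1 by rewrite le_max lexx orbT.
have Z10 : 0 <= Z1 by lra.
have pZ1 := grad_ge0 dp p0 lambda_gt0 m_ge Z10.
(* For [|y| > C] the point [z] with [2 * p z = |y|] lies beyond [Z1], where both the near estimate
   and the growth condition hold; the 1 makes [C] positive. *)
pose C := 2 * p Z1 + 1.
exists C; split=> [|g [dg' cg'] gfin]; first by rewrite /C; lra.
set g' := derive1 g in cg' *.
pose H := H_fun phi A lambda C.
have cost_le (k y : R) : k <= y ^+ 2 / (2 * lambda) ->
    (forall z, Z1 <= z -> `|y| = 2 * p z -> k <= z * `|y|) ->
    (k%:E <= H y)%E.
  move=> ky kz; have [yC|Cy] := leP `|y| C.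
    by rewrite /H /H_fun ltNge yC /= lee_fin mulrC.
  have y0 : 0 <= `|y| / lambda by rewrite divr_ge0// ltW.
  (* The right end is large enough because [p x >= lambda * x] for [x >= 0]. *)
  have [z zZ pz] : exists2 z, z \in `[Z1, Z1 + `|y| / lambda] & p z = `|y| / 2.
    apply: IVT; first by lra.
      exact: continuous_subspaceT.
    have := grad_ge dp p0 m_ge (addr_ge0 Z10 y0).
    rewrite mulrDr mulrCA divff ?gt_eqF// mulr1 => py.
    have lZ : 0 <= lambda * Z1 by rewrite mulr_ge0// ltW.
    by rewrite ge_min le_max; apply/andP; split; apply/orP; [left|right];
      move: Cy; rewrite /C; lra.
  move: zZ; rewrite in_itv/= => /andP[Z1z _].
  have yz : `|y| = 2 * p z by rewrite pz; field.
  have z0 : 0 <= z by lra.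
  have Az : A * phi z <= z * p z by apply: growth; rewrite ger0_norm; lra.
  apply: le_trans (H_fun_ge_linear lambda phi_even A_gt1 z0 Az Cy yz).
  by rewrite lee_fin kz.
pose F x := expR (g x) * expR (- phi x).
have dg := is_derive_derive1 dg'; have cg := is_derive_continuous dg.
have F_gt0 x : 0 < F x by rewrite mulr_gt0 ?expR_gt0.
have cexp : continuous (fun x => expR (- phi x)).
  move=> x; apply: (@continuous_comp _ _ _ (fun x => - phi x) expR).
    by apply: cvgN; exact: cphi.
  exact: continuous_expR.
have cF : continuous F.
  move=> x; apply: cvgM; last exact: cexp.
  by apply: (@continuous_comp _ _ _ g expR); [exact: cg|exact: continuous_expR].
pose m0 := fine (muint phi (fun x => (expR (g x))%:E)).
(* Finiteness of the integral of [e^g] makes [fine] faithful here. *)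
have int_F : (\int[mu]_x (F x)%:E = m0%:E)%E.
  rewrite fineK//.
  rewrite ge0_fin_numE//; apply: integral_ge0 => x _.
  by rewrite mule_ge0// lee_fin expR_ge0.
have m0_gt0 : 0 < m0.
  (* The cumulative function of [F] at 0 lies strictly between 0 and [m0]. *)
  have [N [_ /(_ 0)/andP[N0 NI] _]] := cumulative_exists cF F_gt0 int_F.
  exact: lt_trans N0 NI.
have int_mu : (\int[mu]_x (expR (- phi x))%:E = 1)%E.
  by rewrite -phi_prob; apply: eq_integral => x _; rewrite mul1e.
have int_h : (\int[mu]_x (m0 * expR (- phi x))%:E = m0%:E)%E.
  rewrite -[RHS]mule1 -int_mu; under eq_integral do rewrite EFinM.
  apply: ge0_integralZl => //.
  - by apply/measurable_EFinP; exact: continuous_measurable_fun.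
  - by rewrite lee_fin ltW.
have ch : continuous (fun x => m0 * expR (- phi x)).
  by move=> x; apply: cvgM; [exact: cvg_cst|exact: cexp].
have h_gt0 x : 0 < m0 * expR (- phi x) by rewrite mulr_gt0 ?expR_gt0.
have [T dT] := transport_map_exists cF ch F_gt0 h_gt0 int_F int_h.
have mH : measurable_fun setT H by exact: measurable_H_fun.
have H0 y : (0 <= H y)%E by exact: H_fun_ge0.
have H_even y : H (- y) = H y by exact: H_fun_even.
have := transport_inequality dphi dg cp cg' m0_gt0 mH H0 dT phi_even p_odd
  H_even int_mu X0 M0 K0 _ _ decay.
have far' x t y : X <= x -> ((clamped_cost phi p 1 x t y)%:E <= H y)%E.
  move=> Xx; have [c1 c2] := far x t y Xx.
  by apply: cost_le => // z Zz; apply: c2; lra.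
have near' x t y : 0 <= x <= X -> ((clamped_cost phi p (- M) x t y)%:E <= H y)%E.
  move=> xX; have [c1 c2] := near x t y xX.
  by apply: cost_le => // z Zz; apply: c2; lra.
move=> /(_ far' near').
congr (_ <= _)%E.
  apply: eq_integral => x _; rewrite -EFinM; congr EFin.
  rewrite ln_div ?posrE ?expR_gt0// expRK -/m0; ring.
by apply: eq_integral => x _; rewrite EFinM muleA.
Qed.
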